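(* Let $G$ be a connected simple graph with $n$ vertices and let $F=\{f_i\}_{i\in[n]}$ be an $L_G(n,n-1)$-frame for $\mathbb{C}^{n-1}$. If $\mu_1\ge\mu_2\ge\cdots\ge\mu_{n-1}>\mu_n=0$ are the eigenvalues of the Laplacian matrix of $G$ and $D=\operatorname{diag}(\mu_1^{-1},\mu_2^{-1},\dots,\mu_{n-1}^{-1})$, then the family of dual frames of $F$ is $\left\{\{Df_i+h\}_{i\in[n]} : h\in\mathbb{C}^{n-1}\right\}$.
   Context: $[n]=\{1,\dots,n\}$. A sequence $\{f_i\}_{i\in[n]}$ in $\mathbb{C}^k$ is a frame for $\mathbb{C}^k$ if there are constants $A,B>0$ with $A\|f\|^2\le\sum_{i\in[n]}|\langle f,f_i\rangle|^2\le B\|f\|^2$ for all $f\in\mathbb{C}^k$ (inner product linear in the first argument). A frame $\{g_i\}_{i\in[n]}$ for $\mathbb{C}^k$ is a dual frame of $\{f_i\}_{i\in[n]}$ if $f=\sum_{i\in[n]}\langle f,f_i\rangle g_i=\sum_{i\in[n]}\langle f,g_i\rangle f_i$ for all $f\in\mathbb{C}^k$. The Laplacian matrix of a simple graph $G$ with vertices $v_1,\dots,v_n$ is $L=D(G)-A(G)$, where $D(G)$ is the diagonal matrix of vertex degrees and $A(G)$ is the adjacency matrix; it is positive semi-definite. $L_G(n,k)$-frame: let $L$ have rank $k$ with non-zero eigenvalues $\mu_1\ge\cdots\ge\mu_k>0$ (with multiplicity), and let $M$ be a real orthogonal $n\times n$ matrix with $L=M\,\operatorname{diag}(\mu_1,\dots,\mu_k,0,\dots,0)\,M^*$.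 Let $M_1$ be the $n\times k$ matrix formed by the first $k$ columns of $M$, and put $B=\operatorname{diag}(\sqrt{\mu_1},\dots,\sqrt{\mu_k})\,M_1^*$. With $\{e_i\}_{i\in[n]}$ the standard orthonormal basis of $\mathbb{C}^n$, any frame $\{B(e_i)\}_{i\in[n]}$ for $\mathbb{C}^k$ obtained in this way (for some such $M$) is called an $L_G(n,k)$-frame. For connected $G$, $k=n-1$. *)

(* Defs.v *)
From mathcomp Require Import all_boot all_order all_algebra.
From mathcomp Require Import spectral complex.
From mathcomp Require Import boolp classical_sets reals.

Set Implicit Arguments.
Unset Strict Implicit.
Unset Printing Implicit Defensive.

Import Order.TTheory GRing.Theory Num.Theory.
Local Open Scope ring_scope.
Local Open Scope complex_scope.

(* [dotmx] is the Hermitian product of row vectors, linear in its first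
   argument and conjugate-linear in the second. *)
Definition cdot (R : realType) (k : nat) (x y : 'cV[R[i]]_k) : R[i] :=
  dotmx x^T y^T.

(* The squared norm of [x] is [cdot x x]; [`|x|] on matrices would be the
   sup norm.  The inequalities are in the partial order of [R[i]]; all the
   quantities compared are real. *)
Definition is_frame (R : realType) (n k : nat) (f : 'I_n -> 'cV[R[i]]_k) : Prop :=
  exists A B : R, [/\ 0 < A, 0 < B &
    forall x : 'cV[R[i]]_k,
      A%:C * cdot x x <= \sum_(i < n) `|cdot x (f i)| ^+ 2 /\
      \sum_(i < n) `|cdot x (f i)| ^+ 2 <= B%:C * cdot x x].

Definition dual_frame (R : realType) (n k : nat)
    (f g : 'I_n -> 'cV[R[i]]_k) : Prop :=
  is_frame g /\
  forall x : 'cV[R[i]]_k,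
    x = \sum_(i < n) cdot x (f i) *: g i /\
    x = \sum_(i < n) cdot x (g i) *: f i.

Definition simple_graph (n : nat) (e : rel 'I_n) : Prop :=
  symmetric e /\ irreflexive e.

Definition connected_graph (n : nat) (e : rel 'I_n) : Prop :=
  (0 < n)%N /\ forall x y : 'I_n, connect e x y.

Definition degree_mx (R : realType) (n : nat) (e : rel 'I_n) : 'M[R]_n :=
  diag_mx (\row_(i < n) #|[set j | e i j]|%:R).

Definition adjacency_mx (R : realType) (n : nat) (e : rel 'I_n) : 'M[R]_n :=
  \matrix_(i < n, j < n) (e i j)%:R.

Definition laplacian (R : realType) (n : nat) (e : rel 'I_n) : 'M[R]_n :=
  degree_mx R e - adjacency_mx R e.

(* [mu] lists all [n] eigenvalues of [A], with multiplicity, in nonincreasing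
   order. *)
Definition ordered_eigenvalues (R : realType) (n : nat)
    (A : 'M[R]_n) (mu : 'rV[R]_n) : Prop :=
  char_poly A = \prod_(i < n) ('X - (mu 0 i)%:P) /\
  forall i j : 'I_n, (i <= j)%N -> mu 0 j <= mu 0 i.

Definition frame_matrix (R : realType) (n k : nat) (hk : (k <= n)%N)
    (mu : 'rV[R]_n) (M : 'M[R]_n) : 'M[R]_(k, n) :=
  diag_mx (\row_(j < k) Num.sqrt (mu 0 (widen_ord hk j)))
    *m (colsub (widen_ord hk) M)^T.

(* The real matrix [B] acts on C^n through its entrywise embedding, and
   [delta_mx i 0] is the standard basis vector e_i of C^n.  Since [M] is real,
   its adjoint is its transpose. *)
Definition laplacian_frame (R : realType) (n k : nat) (e : rel 'I_n)
    (f : 'I_n -> 'cV[R[i]]_k) : Prop :=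
  is_frame f /\
  exists (hk : (k <= n)%N) (mu : 'rV[R]_n) (M : 'M[R]_n),
    [/\ \rank (laplacian R e) = k,
        ordered_eigenvalues (laplacian R e) mu,
        forall i : 'I_n, (i < k)%N -> 0 < mu 0 i &
    [/\ M *m M^T = 1%:M,
        laplacian R e =
          M *m diag_mx (\row_(i < n) (if (i < k)%N then mu 0 i else 0)) *m M^T &
        forall i : 'I_n,
          f i = map_mx (real_complex R) (frame_matrix hk mu M)
                  *m delta_mx i (0 : 'I_1)]].

(* Main.v *)
Require Import Defs.
From mathcomp Require Import all_boot all_order all_algebra.
From mathcomp Require Import spectral complex.
From mathcomp Require Import boolp classical_sets reals.

Set Implicit Arguments.
Unset Strict Implicit.
Unset Printing Implicit Defensive.

Import Order.TTheory GRing.Theory Num.Theory.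
Local Open Scope classical_set_scope.
Local Open Scope ring_scope.
Local Open Scope complex_scope.

(** Write F for the matrix whose columns are the frame vectors, and G for that
    of another family of vectors. Since x |-> sum_i <x, f_i> g_i is the matrix
    G F*, the two reconstruction formulas of a dual pair say G F* = 1 and
    F G* = 1, which are adjoint to each other; and either of them already
    forces the g_i to be a frame, the upper bound being Cauchy-Schwarz and the
    lower one Cauchy-Schwarz applied to x = F (G* x). Hence the dual frames of
    F are exactly the left inverses of F* ([dual_frameP]).

    For a Laplacian frame F is real, and the spectral decomposition of L gives
    F F* = diag(mu_1, ..., mu_(n-1)) = D^-1 ([frame_matrix_gram]), so that D F
    is one left inverse of F*. Two left inverses of F* differ by a matrix whose
    rows annihilate F*. As F* has n rows and rank n - 1, these annihilating
    rows form a line ([left_inverse_coset]). That line is spanned by the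
    all-ones row: F L = D^-1 F ([frame_matrix_eigen]) and L kills the constant
    vectors ([laplacian_const]), so F kills them too. Thus the left inverses of
    F* are the matrices D F + h (1, ..., 1), whose i-th column is D f_i + h.

    The eigenvalues in D and those from which the frame was built are two
    decreasing enumerations of the same spectrum, hence equal
    ([ordered_eigenvalues_inj]). *)

Section Reconstruction.
Local Open Scope sesquilinear_scope.
Variable R : realType.

Definition synthesis (n k : nat) (g : 'I_n -> 'cV[R[i]]_k) : 'M[R[i]]_(k, n) :=
  \matrix_(a, i) g i a 0.

Lemma cdot_analysis (n k : nat) (g : 'I_n -> 'cV[R[i]]_k) (x : 'cV_k) i :
  cdot x (g i) = ((synthesis g)^t* *m x) i 0.
Proof.
rewrite /cdot dotmxE !mxE; apply: eq_bigr => a _.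
by rewrite !mxE mulrC.
Qed.

Lemma sum_cdot (n k : nat) (f g : 'I_n -> 'cV[R[i]]_k) (x : 'cV_k) :
  \sum_i cdot x (f i) *: g i = synthesis g *m (synthesis f)^t* *m x.
Proof.
rewrite -mulmxA; apply/colP => a; rewrite summxE mxE.
by apply: eq_bigr => i _; rewrite mxE cdot_analysis [synthesis g a i]mxE mulrC.
Qed.

Lemma reconstructionP (n k : nat) (f g : 'I_n -> 'cV[R[i]]_k) :
  (forall x, x = \sum_i cdot x (f i) *: g i) <->
  synthesis g *m (synthesis f)^t* = 1%:M.
Proof.
split=> [rec | GF1 x]; last by rewrite sum_cdot GF1 mul1mx.
apply/trmx_inj/row_matrixP => a; rewrite -!tr_col; congr (_^T).
by rewrite colE -sum_cdot -rec -[delta_mx a 0]mul1mx colE.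
Qed.

Lemma cdot_ge0 (k : nat) (x : 'cV[R[i]]_k) : 0 <= cdot x x.
Proof.
rewrite /cdot dotmxE mxE; apply: sumr_ge0 => i _.
by rewrite !mxE mul_conjC_ge0.
Qed.

(** By Cauchy-Schwarz the sum of the squared norms of the vectors is a bound;
    adding 1 keeps it positive when they all vanish. *)
Lemma bessel_bound (n k : nat) (g : 'I_n -> 'cV[R[i]]_k) :
  exists2 C : R, 0 < C & forall x : 'cV[R[i]]_k,
    \sum_i `|cdot x (g i)| ^+ 2 <= C%:C * cdot x x.
Proof.
pose S : R[i] := \sum_i cdot (g i) (g i).
have S_ge0 : 0 <= S by apply: sumr_ge0 => i _; apply: cdot_ge0.
have SE : S = (complex.Re S)%:C.
  by case: (S) S_ge0 => a b; rewrite lecE /= => /andP[/eqP-> _].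
have ReS_ge0 : 0 <= complex.Re S by rewrite -(@ler0c R) -SE.
exists (1 + complex.Re S) => [|x]; first by rewrite ltr_wpDr.
apply: (@le_trans _ _ (S * cdot x x)).
  rewrite mulr_suml; apply: ler_sum => i _; rewrite mulrC.
  exact: (CauchySchwarz (@dotmx _ _) x^T (g i)^T).1.
apply: ler_wpM2r; first exact: cdot_ge0.
by rewrite {1}SE lecR lerDr.
Qed.

(** Any family from which vectors can be reconstructed linearly is a frame: the
    lower bound says that x = F (G* x) depends boundedly on G* x, which is
    [bessel_bound] for the rows of F. *)
Lemma reconstruction_is_frame (n k : nat) (f g : 'I_n -> 'cV[R[i]]_k) :
  synthesis f *m (synthesis g)^t* = 1%:M -> is_frame g.
Proof.
move=> FG1; have [B B_gt0 upper] := bessel_bound g.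
(* The conjugates make <y, r a> the a-th coordinate of the bilinear product
   F y, as the inner product conjugates its second argument. *)
pose r (a : 'I_k) : 'cV[R[i]]_n := (row a (synthesis f))^t*.
have [C C_gt0 lower] := bessel_bound r.
exists C^-1, B; split; rewrite ?invr_gt0 // => x; split; last exact: upper.
pose y := (synthesis g)^t* *m x.
have normE (m : nat) (z : 'cV[R[i]]_m) : cdot z z = \sum_i `|z i 0| ^+ 2.
  rewrite /cdot dotmxE mxE; apply: eq_bigr => i _.
  by rewrite !mxE -normCK.
have xE a : x a 0 = cdot y (r a).
  rewrite -{1}[x]mul1mx -FG1 -mulmxA -/y mxE /cdot dotmxE mxE.
  apply: eq_bigr => i _; rewrite mulrC.
  by congr (_ * _); rewrite [RHS]mxE // !mxE conjCK.
have -> : \sum_i `|cdot x (g i)| ^+ 2 = cdot y y.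
  by rewrite normE; apply: eq_bigr => i _; rewrite cdot_analysis.
have CC_gt0 : 0 < C%:C by rewrite (ltcR 0).
rewrite fmorphV mulrC ler_pdivrMr // mulrC normE.
under eq_bigr do rewrite xE.
exact: lower.
Qed.

(** One reconstruction formula is enough: the other is its adjoint, and the
    frame bounds follow from it. *)
Lemma dual_frameP (n k : nat) (f g : 'I_n -> 'cV[R[i]]_k) :
  dual_frame f g <-> synthesis g *m (synthesis f)^t* = 1%:M.
Proof.
split=> [[_ rec] | GF1].
  by apply/reconstructionP => x; have [] := rec x.
have FG1 : synthesis f *m (synthesis g)^t* = 1%:M.
  have /(congr1 (fun A => A^t*)) := GF1.
  by rewrite trmx_mul map_mxM /= trmxCK trmx1 map_mx1.
split; first exact: reconstruction_is_frame FG1.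
by move=> x; split; apply/reconstructionP: x.
Qed.

End Reconstruction.

(** The rows x with x H = 0 form a space of dimension k + 1 - rank H = 1, so a
    single nonzero u spans it, and each row of G - A is a multiple of u. *)
Lemma left_inverse_coset (K : fieldType) (k : nat) (H : 'M[K]_(k.+1, k))
    (A G : 'M[K]_(k, k.+1)) (u : 'rV[K]_k.+1) :
  A *m H = 1%:M -> u != 0 -> u *m H = 0 ->
  G *m H = 1%:M <-> exists h : 'cV[K]_k, G = A + h *m u.
Proof.
move=> AH1 u_neq0 uH0; split=> [GH1 | [h ->]]; last first.
  by rewrite mulmxDl -mulmxA uH0 mulmx0 addr0.
have rankH : \rank H = k.
  apply/eqP; rewrite eqn_leq rank_leq_col /=.
  by have := mxrankM_maxr A H; rewrite AH1 mxrank1.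
have u_ker : (u <= kermx H)%MS by apply/sub_kermxP.
have ker_u : (kermx H <= u)%MS.
  (* The inclusion u_ker is reversed by comparing dimensions: both are 1. *)
  rewrite -(geq_leqif (mxrank_leqif_sup u_ker)).
  by rewrite mxrank_ker rankH subSnn rank_rV u_neq0.
have GA_ker : (G - A <= kermx H)%MS.
  by apply/sub_kermxP; rewrite mulmxBl GH1 AH1 subrr.
have /submxP[h GA] := submx_trans GA_ker ker_u.
by exists h; rewrite -GA addrC subrK.
Qed.

(** The roots of the characteristic polynomial are determined up to a
    permutation, and there is only one way to sort them. *)
Lemma ordered_eigenvalues_inj (R : realType) (n : nat) (A : 'M[R]_n)
    (mu nu : 'rV[R]_n) :
  ordered_eigenvalues A mu -> ordered_eigenvalues A nu -> mu = nu.
Proof.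
move=> [charmu decmu] [charnu decnu].
pose s (d : 'rV[R]_n) := [seq d 0 i | i <- enum 'I_n].
have s_sorted (d : 'rV[R]_n) :
    (forall i j : 'I_n, (i <= j)%N -> d 0 j <= d 0 i) -> sorted >=%O (s d).
  move=> dec; apply: (@homo_sorted _ _ _ (relpre val leq)) => [i j|].
    exact: dec.
  by rewrite -sorted_map val_enum_ord iota_sorted.
have s_prod (d : 'rV[R]_n) :
    \prod_(x <- s d) ('X - x%:P) = \prod_(i < n) ('X - (d 0 i)%:P).
  by rewrite big_map enumT.
have : s mu = s nu.
  apply: (@sorted_eq _ >=%O); rewrite ?s_sorted //.
  - exact: ge_trans.
  - exact: ge_anti.
  - by apply: prod_XsubC_eq; rewrite !s_prod -charmu.
move=> /eq_in_map munu; apply/rowP => i.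
by apply: munu; rewrite mem_enum.
Qed.

Section FrameMatrix.
Variables (R : realType) (n k : nat) (hk : (k <= n)%N).
Variables (mu : 'rV[R]_n) (M : 'M[R]_n).
Hypothesis M_orth : M *m M^T = 1%:M.

Let w := widen_ord hk.
Let B := frame_matrix hk mu M.
Let mu1 : 'rV[R]_k := \row_j mu 0 (w j).

(** This is the frame operator of the Laplacian frame: the columns of [M]
    indexed by [w] are orthonormal, so only the squared square roots remain. *)
Lemma frame_matrix_gram :
  (forall i : 'I_n, (i < k)%N -> 0 <= mu 0 i) -> B *m B^T = diag_mx mu1.
Proof.
move=> mu_ge0.
have orth1 : (colsub w M)^T *m colsub w M = 1%:M.
  rewrite trmx_mxsub -mxsub_mul (mulmx1C M_orth).
  by apply/matrixP => i j; rewrite !mxE.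
rewrite /B /frame_matrix trmx_mul trmxK tr_diag_mx -mulmxA.
rewrite (mulmxA (colsub w M)^T) orth1 mul1mx mulmx_diag.
congr diag_mx; apply/rowP => j; rewrite !mxE -expr2 sqr_sqrtr //.
by apply: mu_ge0 => /=.
Qed.

(** The rows of [B] are multiples of rows of M^T, which are eigenvectors. This
    turns vectors killed by the Laplacian into vectors killed by [B]. *)
Lemma frame_matrix_eigen :
  B *m (M *m diag_mx (\row_(i < n) (if (i < k)%N then mu 0 i else 0)) *m M^T)
  = diag_mx mu1 *m B.
Proof.
set d := \row_i _.
have rows : (colsub w M)^T *m M *m diag_mx d = diag_mx mu1 *m rowsub w 1%:M.
  rewrite trmx_mxsub mul_rowsub_mx (mulmx1C M_orth).
  apply/matrixP => i j; rewrite mul_mx_diag mul_diag_mx !mxE.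
  case: eqP => [<-|_]; last by rewrite mul0r mulr0.
  by rewrite /= ltn_ord mul1r mulr1.
rewrite /B /frame_matrix -!mulmxA (mulmxA M) (mulmxA _ (M *m _)) (mulmxA _ M).
rewrite rows -mulmxA -rowsubE -trmx_mxsub !mulmxA; congr (_ *m _).
by rewrite !mulmx_diag; congr diag_mx; apply/rowP => j; rewrite !mxE mulrC.
Qed.

End FrameMatrix.

Lemma laplacian_const (R : realType) (n : nat) (e : rel 'I_n) (a : R) :
  laplacian R e *m const_mx a = 0 :> 'cV_n.
Proof.
apply/colP => i; rewrite mulmxBl mul_diag_mx !mxE.
under eq_bigr do rewrite !mxE.
rewrite -mulr_suml -natr_sum -[X in _ - X%:R * _]big_mkcond /= sum1_card.
by rewrite cardsE subrr.
Qed.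

Theorem corollary3p12 (R : realType) (n : nat) (e : rel 'I_n)
    (he : simple_graph e) (hconn : connected_graph e)
    (f : 'I_n -> 'cV[R[i]]_(n.-1)) (hf : laplacian_frame e f)
    (mu : 'rV[R]_n) (hmu : ordered_eigenvalues (laplacian R e) mu)
    (hmu_gt0 : forall i : 'I_n, (i < n.-1)%N -> 0 < mu 0 i)
    (hmu_last : forall i : 'I_n, i = n.-1 :> nat -> mu 0 i = 0)
    (D : 'M[R[i]]_(n.-1))
    (hD : D = diag_mx (\row_(j < n.-1)
                ((mu 0 (widen_ord (leq_pred n) j))^-1)%:C)) :
  [set g : 'I_n -> 'cV[R[i]]_(n.-1) | dual_frame f g] =
  [set (fun i : 'I_n => D *m f i + h) | h in [set: 'cV[R[i]]_(n.-1)]].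
Proof.
have n_gt0 := hconn.1.
case: n => [//|n] in e he hconn f hf mu hmu hmu_gt0 hmu_last D hD n_gt0 *.
rewrite /= in f hf hmu_gt0 hmu_last D hD *.
have [_ [hk [nu [M [_ hnu _ [M_orth LE fE]]]]]] := hf.
have nuE : nu = mu := ordered_eigenvalues_inj hnu hmu.
subst nu; set B := frame_matrix hk mu M in fE.
pose mu1 : 'rV[R]_n := \row_j mu 0 (widen_ord hk j).
pose Dr : 'M[R]_n := diag_mx (\row_j (mu1 0 j)^-1).
have DE : D = map_mx (real_complex R) Dr.
  rewrite hD /Dr map_diag_mx; congr diag_mx; apply/rowP => j; rewrite !mxE.
  by rewrite (_ : widen_ord _ j = widen_ord hk j) //; apply: val_inj.
have Dr_inv : Dr *m diag_mx mu1 = 1%:M.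
  rewrite mulmx_diag -(scale1r 1%:M) scalemx1 -diag_const_mx.
  congr diag_mx; apply/rowP => j.
  by rewrite !mxE mulVf // gt_eqF // hmu_gt0 /=.
have BB : B *m B^T = diag_mx mu1.
  by apply: frame_matrix_gram => // i /hmu_gt0/ltW.
(* F 1 = D (D^-1 F) 1 = D F L 1 = 0. *)
have B1 : B *m const_mx 1 = 0 :> 'cV_n.
  rewrite -[B]mul1mx -Dr_inv -[_ *m B]mulmxA -(frame_matrix_eigen hk mu M_orth).
  by rewrite -LE -!mulmxA laplacian_const !mulmx0.
have FE : synthesis f = map_mx (real_complex R) B.
  by apply/matrixP => a i; rewrite mxE fE -colE mxE.
have FadjE : map_mx Num.conj (synthesis f)^T = map_mx (real_complex R) B^T.
  by rewrite FE; apply/matrixP => i a; rewrite !mxE; apply: conjc_real.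
pose u : 'rV[R[i]]_n.+1 := const_mx 1.
have u_neq0 : u != 0.
  by apply/eqP => /rowP/(_ 0); rewrite !mxE => /eqP; rewrite oner_eq0.
have uF : u *m map_mx (real_complex R) B^T = 0.
  rewrite (_ : u = map_mx (real_complex R) (const_mx 1 : 'cV_n.+1)^T).
    by rewrite -map_mxM -trmx_mul B1 trmx0 map_mx0.
  by apply/rowP => j; rewrite !mxE.
have DFF : D *m synthesis f *m map_mx (real_complex R) B^T = 1%:M.
  by rewrite FE DE -!map_mxM -mulmxA BB Dr_inv map_mx1.
have cosetE (g : 'I_n.+1 -> 'cV[R[i]]_n) (h : 'cV[R[i]]_n) :
    synthesis g = D *m synthesis f + h *m u <->
    (fun i => D *m f i + h) = g.
  have entry a i : (D *m synthesis f + h *m u) a i = (D *m f i + h) a 0.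
    rewrite !mxE big_ord1 mxE mulr1; congr (_ + _).
    by apply: eq_bigr => b _; rewrite mxE.
  split=> [GE | <-].
    apply/funext => i; apply/colP => a.
    by rewrite -entry -GE mxE.
  by apply/matrixP => a i; rewrite entry mxE.
apply/seteqP; split=> g /=.
  move=> /dual_frameP; rewrite FadjE => /(left_inverse_coset _ DFF u_neq0 uF).
  by case=> h /cosetE gE; exists h.
case=> h _ /cosetE gE; apply/dual_frameP; rewrite FadjE.
by apply/(left_inverse_coset _ DFF u_neq0 uF); exists h.
Qed.
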